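(* Let $T_1:X_1\to X_1$ and $T_2:X_2\to X_2$ be aperiodic homeomorphisms of Cantor sets $X_1$ and $X_2$. If $T_2$ is a continuous factor of $T_1$, then the topological full group $[[T_2]]$ embeds into $[[T_1]]$, i.e., there exists an injective group homomorphism $[[T_2]]\to[[T_1]]$.
   Context: A Cantor set is a compact metrizable totally disconnected topological space without isolated points. A transformation $T:X\to X$ is aperiodic if $T^n(x)\ne x$ for all $x\in X$ and all integers $n\ge1$. $T_2$ is a continuous factor of $T_1$ if there is a continuous onto map $f:X_1\to X_2$ with $fT_1=T_2f$. For a homeomorphism $T:X\to X$ of a Cantor set $X$, the topological full group $[[T]]$ is the group (under composition) of all homeomorphisms $F:X\to X$ of the form $F(x)=T^{\nu(x)}(x)$, $x\in X$, for some continuous function $\nu:X\to\mathbb{Z}$. *)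

(* Defs.v *)
From HB Require Import structures.
From mathcomp Require Import all_boot all_order all_algebra.
From mathcomp Require Import all_classical reals topology.

Set Implicit Arguments.
Unset Strict Implicit.
Unset Printing Implicit Defensive.

Import GRing.Theory Num.Theory.
Local Open Scope classical_set_scope.
Local Open Scope ring_scope.
Local Open Scope group_scope.

Definition metrizable (R : realType) (X : topologicalType) : Prop :=
  exists d : X -> X -> R,
    [/\ forall x y, 0 <= d x y,
        forall x y, d x y = 0 <-> x = y,
        forall x y, d x y = d y x,
        forall x y z, d x z <= d x y + d y z &
        forall (x : X) (A : set X),
          nbhs x A <-> exists2 e : R, 0 < e & [set y | d x y < e] `<=` A]%R.

Definition cantor_set (R : realType) (X : topologicalType) : Prop :=
  [/\ compact [set: X],
      metrizable R X,
      totally_disconnected [set: X] &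
      isolated [set: X] = set0].

Definition aperiodic (X : Type) (T : X -> X) : Prop :=
  forall (x : X) (n : nat), (1 <= n)%N -> iter n T x <> x.

Definition continuous_factor (X1 X2 : topologicalType)
    (T2 : X2 -> X2) (T1 : X1 -> X1) : Prop :=
  exists f : X1 -> X2,
    [/\ continuous f, set_surj [set: X1] [set: X2] f & f \o T1 = T2 \o f].

(* The inverse is stored as data; it is determined by the underlying map, so
   equality of homeomorphisms is equality of maps ([homeo_ext] below). *)
Record homeo (X : topologicalType) : Type := Homeo {
  homeo_fun :> X -> X;
  homeo_inv : X -> X;
  homeo_funK : cancel homeo_fun homeo_inv;
  homeo_invK : cancel homeo_inv homeo_fun;
  homeo_continuous : continuous homeo_fun;
  homeo_inv_continuous : continuous homeo_inv
}.

Section HomeoGroup.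
Context {X : topologicalType}.
Implicit Types F G H : homeo X.

Lemma homeo_ext F G : homeo_fun F =1 homeo_fun G -> F = G.
Proof.
case: F G => [f f' fK f'K cf cf'] [g g' gK g'K cg cg'] /= /funext fg.
subst g; have fg' : f' = g'.
  by apply/funext => x; rewrite -{1}[x]g'K fK.
by subst g'; congr Homeo; exact: Prop_irrelevance.
Qed.

HB.instance Definition _ := gen_eqMixin (homeo X).
HB.instance Definition _ := gen_choiceMixin (homeo X).

Definition homeo_one : homeo X :=
  @Homeo X id id (fun=> erefl) (fun=> erefl) (fun=> cvg_id) (fun=> cvg_id).

Definition homeo_opp F : homeo X :=
  Homeo (@homeo_invK X F) (@homeo_funK X F)
        (@homeo_inv_continuous X F) (@homeo_continuous X F).

Lemma homeo_comp_continuous (f g : X -> X) :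
  continuous f -> continuous g -> continuous (f \o g).
Proof. by move=> cf cg x; apply: continuous_comp; [exact: cg|exact: cf]. Qed.

Definition homeo_mul F G : homeo X :=
  @Homeo X (F \o G) (homeo_inv G \o homeo_inv F)
    (can_comp (@homeo_funK X F) (@homeo_funK X G))
    (can_comp (@homeo_invK X G) (@homeo_invK X F))
    (homeo_comp_continuous (@homeo_continuous X F) (@homeo_continuous X G))
    (homeo_comp_continuous (@homeo_inv_continuous X G)
                           (@homeo_inv_continuous X F)).

Lemma homeo_mulA : associative homeo_mul.
Proof. by move=> F G H; apply: homeo_ext. Qed.

Lemma homeo_mul1 : left_id homeo_one homeo_mul.
Proof. by move=> F; apply: homeo_ext. Qed.

Lemma homeo_mulr1 : right_id homeo_one homeo_mul.
Proof. by move=> F; apply: homeo_ext. Qed.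

Lemma homeo_mulV : left_inverse homeo_one homeo_opp homeo_mul.
Proof. by move=> F; apply: homeo_ext => x /=; rewrite homeo_funK. Qed.

Lemma homeo_mulrV : right_inverse homeo_one homeo_opp homeo_mul.
Proof. by move=> F; apply: homeo_ext => x /=; rewrite homeo_invK. Qed.

HB.instance Definition _ := isGroup.Build (homeo X)
  homeo_mulA homeo_mul1 homeo_mulr1 homeo_mulV homeo_mulrV.

Lemma homeo_oneE x : (1 : homeo X) x = x. Proof. by []. Qed.

Lemma homeo_mulE F G x : (F * G) x = F (G x). Proof. by []. Qed.

Lemma homeo_invE F x : F^-1 x = homeo_inv F x. Proof. by []. Qed.

End HomeoGroup.

Definition expgz (G : groupType) (x : G) (n : int) : G :=
  match n with
  | Posz m => x ^+ m
  | Negz m => x ^- m.+1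
  end.

Section ExpgzTheory.
Context {G : groupType}.
Implicit Types (x : G) (m n : int).

Lemma expgzS x n : expgz x (n + 1)%R = x * expgz x n.
Proof.
have posS (m : nat) : (Posz m + 1)%R = Posz m.+1 by rewrite -[m.+1]addn1 PoszD.
case: n => [n|[|n]].
- by rewrite posS /= expgS.
- by rewrite /= expg1 mulgV.
have -> : (Negz n.+1 + 1)%R = Negz n.
  by rewrite !NegzE -posS opprD addrNK.
by rewrite /= [x ^+ n.+2]expgSr invgM mulVKg.
Qed.

Lemma expgzB1 x n : expgz x (n - 1)%R = x^-1 * expgz x n.
Proof. by rewrite -{2}[n](subrK 1%R) expgzS mulKg. Qed.

Lemma expgzD x m n : expgz x (m + n)%R = expgz x m * expgz x n.
Proof.
elim/int_rec: m => [|m IH|m IH].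
- by rewrite add0r mul1g.
- by rewrite intS [(1 + _)%R]addrC addrAC !expgzS IH mulgA.
- by rewrite intS [(1 + _)%R]addrC opprD addrAC !expgzB1 IH mulgA.
Qed.

Lemma expgzN x n : expgz x (- n)%R = (expgz x n)^-1.
Proof.
by apply: (mulIg (expgz x n)); rewrite -expgzD addNr mulVg.
Qed.

End ExpgzTheory.

Section FullGroup.
Context {X : topologicalType}.
Variable T : homeo X.

Definition full_group_set : set (homeo X) :=
  [set F | exists2 nu : X -> discrete_topology int,
             continuous nu & forall x, F x = expgz T (nu x) x].

Lemma full_group_closed : group_closed (mem full_group_set).
Proof.
split=> [|F G].
  by apply/mem_set; exists (fun=> 0%R : int) => //; exact: cst_continuous.
move=> /set_mem[nu cnu FE] /set_mem[mu cmu GE]; apply/mem_set.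
pose a x : X := G^-1 x.
have ca : continuous a by exact: homeo_inv_continuous.
exists (fun x => (nu (a x) - mu (a x))%R : int).
  move=> x; apply/discrete_cvg.
  have nuax : \forall y \near x, nu (a y) = nu (a x).
    apply: (ca x [set z | nu z = nu (a x)]).
    by apply: (cnu (a x) [set nu (a x)]); exact: discrete_set1.
  have muax : \forall y \near x, mu (a y) = mu (a x).
    apply: (ca x [set z | mu z = mu (a x)]).
    by apply: (cmu (a x) [set mu (a x)]); exact: discrete_set1.
  rewrite /fmap /=; near=> y; rewrite /=.
  have -> : nu (a y) = nu (a x) by near: y.
  by have -> : mu (a y) = mu (a x) by near: y.
move=> x; rewrite homeo_mulE FE -/(a x) expgzD homeo_mulE expgzN.
congr (homeo_fun _ _); have : G (a x) = x by exact: homeo_invK.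
rewrite GE; set g := expgz T _ => gax; rewrite homeo_invE -[in RHS]gax.
by rewrite homeo_funK.
Unshelve. all: by end_near.
Qed.

Definition topological_full_group : Type := set_type full_group_set.

HB.instance Definition _ := SubChoice.on topological_full_group.
HB.instance Definition _ :=
  SubChoice_isSubGroup.Build (homeo X) _ topological_full_group full_group_closed.

End FullGroup.

(* Main.v *)
(** A homeomorphism [F] in [[T2]] determines its cocycle [nu] because [T2] is
    aperiodic.  Pulling [nu] back along the factor map [f] gives the map
    [x |-> T1^(nu (f x)) x], which [f] intertwines with [F]; the cocycle identity
    [nu_(F G) = nu_F \o G + nu_G] makes this multiplicative in [F], and
    surjectivity of [f] makes it injective. *)

From HB Require Import structures.
Require Import Defs.
From mathcomp Require Import all_boot all_order all_algebra.
From mathcomp Require Import all_classical reals topology.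

Set Implicit Arguments.
Unset Strict Implicit.
Unset Printing Implicit Defensive.

Import GRing.Theory.
Local Open Scope classical_set_scope.

Lemma homeo_expgE (X : topologicalType) (T : homeo X) (n : nat) (x : X) :
  (T ^+ n)%g x = iter n T x.
Proof. by elim: n => [//|n IHn]; rewrite expgS homeo_mulE IHn. Qed.

Lemma homeo_expgzNK (X : topologicalType) (T : homeo X) (n : int) (x : X) :
  expgz T (- n)%R (expgz T n x) = x.
Proof. by rewrite -homeo_mulE -expgzD addNr. Qed.

Lemma homeo_expgz_intertwine (X1 X2 : topologicalType)
    (T1 : homeo X1) (T2 : homeo X2) (f : X1 -> X2) (n : int) (x : X1) :
  f \o T1 = T2 \o f -> f (expgz T1 n x) = expgz T2 n (f x).
Proof.
move=> /funeqP fT; have fTn (m : nat) y : f ((T1 ^+ m)%g y) = (T2 ^+ m)%g (f y).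
  by rewrite !homeo_expgE; elim: m => //= m <-; exact: fT.
case: n => n; first exact: fTn.
(* For a negative exponent, applying the injective map [T2 ^+ n.+1] to both sides and moving it
   through [f] cancels the inverse powers. *)
apply: (can_inj (@homeo_funK _ (T2 ^+ n.+1)%g)); rewrite -fTn.
rewrite -[LHS]/(f (_ (homeo_inv _ x))) -[RHS]/(_ (homeo_inv _ (f x))).
by rewrite !homeo_invK.
Qed.

(** If the powers [m] and [n] of [T] agree at [x], then the power [m - n] fixes [x], so aperiodicity
    forces [m = n]. This is what makes cocycles unique. *)
Lemma aperiodic_expgz_inj (X : topologicalType) (T : homeo X) (x : X) :
  aperiodic T -> injective (fun n : int => expgz T n x).
Proof.
move=> aT; have fix0 (k : int) : expgz T k x = x -> k = 0%R.
  have fixn (m : nat) : (T ^+ m)%g x = x -> m = 0%N.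
    by rewrite homeo_expgE; case: m => // m /aT-/(_ isT).
  case: k => m /= Tx; first by rewrite (fixn m).
  (* A point fixed by the inverse of [T ^+ m.+1] is also fixed by [T ^+ m.+1] itself. *)
  by have /fixn : (T ^+ m.+1)%g x = x by rewrite -{1}Tx; exact: homeo_invK.
move=> m n /= Tmn; apply/eqP; rewrite -subr_eq0; apply/eqP/fix0.
by rewrite addrC expgzD homeo_mulE Tmn homeo_expgzNK.
Qed.

(** Since its target is discrete, [nu] is locally constant, so near each point the map coincides
    with a single power of [T]. *)
Lemma expgz_cocycle_continuous (X : topologicalType) (T : homeo X)
    (nu : X -> discrete_topology int) :
  continuous nu -> continuous (fun x => expgz T (nu x) x).
Proof.
move=> cnu x; have nux : \forall y \near x, nu x = nu y.
  apply: (cnu x [set k | nu x = k]); rewrite -[X in nbhs _ X]/[set _ | _ = _].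
  by rewrite nbhs_principalE.
rewrite /continuous_at; have := @homeo_continuous _ (expgz T (nu x)) x.
apply: cvg_trans; apply: near_eq_cvg.
by near=> y; congr (homeo_fun (expgz T _) y); near: y.
Unshelve. all: by end_near.
Qed.

Section Cocycle.
Context {X : topologicalType} {T : homeo X}.
Implicit Types F G : topological_full_group T.

(** An arbitrary choice among the witnesses of membership; uniqueness enters only with [aT]
    below. *)
Definition cocycle F : X -> discrete_topology int := s2val (cid2 (set_valP F)).

Lemma cocycle_continuous F : continuous (cocycle F).
Proof. exact: (s2valP (cid2 (set_valP F))). Qed.

Lemma cocycleE F x : val F x = expgz T (cocycle F x) x.
Proof. exact: (s2valP' (cid2 (set_valP F))). Qed.

Hypothesis aT : aperiodic T.

Lemma cocycle1 x : cocycle 1%g x = 0%R.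
Proof. by apply: (aperiodic_expgz_inj (x := x) aT); rewrite -cocycleE. Qed.

(** Both sides are exponents of [T] that send [x] to [F (G x)]. *)
Lemma cocycleM F G x :
  cocycle (F * G)%g x = (cocycle F (val G x) + cocycle G x)%R.
Proof.
apply: (aperiodic_expgz_inj (x := x) aT).
by rewrite -cocycleE expgzD [RHS]homeo_mulE -(cocycleE G) -cocycleE.
Qed.

End Cocycle.

Section Lift.
Context {X1 X2 : topologicalType} {T1 : homeo X1} {T2 : homeo X2} {f : X1 -> X2}.
Hypotheses (aT2 : aperiodic T2) (cf : continuous f).
Hypothesis fT : f \o T1 = T2 \o f.
Implicit Types F G : topological_full_group T2.

Definition lift_fun F (x : X1) : X1 := expgz T1 (cocycle F (f x)) x.

Lemma lift_fun_intertwine F x : f (lift_fun F x) = val F (f x).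
Proof. by rewrite /lift_fun (homeo_expgz_intertwine _ _ fT) -cocycleE. Qed.

Lemma lift_cocycle_continuous F : continuous (cocycle F \o f).
Proof.
by move=> x; apply: continuous_comp; [exact: cf | exact: cocycle_continuous].
Qed.

Lemma lift_fun_continuous F : continuous (lift_fun F).
Proof. exact: expgz_cocycle_continuous (@lift_cocycle_continuous F). Qed.

Lemma lift_fun1 : lift_fun 1%g =1 id.
Proof. by move=> x; rewrite /lift_fun cocycle1. Qed.

Lemma lift_funM F G : lift_fun (F * G)%g =1 lift_fun F \o lift_fun G.
Proof.
(* The outer cocycle is read at [f (lift_fun G x)], which is [val G (f x)], exactly the base point
   in [cocycleM]. *)
move=> x; rewrite /= {2}/lift_fun lift_fun_intertwine /lift_fun.
by rewrite cocycleM // expgzD.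
Qed.

(** Multiplicativity alone provides the inverse: it is the lift of [F^-1], hence continuous for the
    same reason as the lift of [F]. *)
Lemma lift_funK F : cancel (lift_fun F) (lift_fun F^-1%g).
Proof. by move=> x; rewrite -[LHS]/((_ \o _) x) -lift_funM mulVg lift_fun1. Qed.

Lemma lift_funVK F : cancel (lift_fun F^-1%g) (lift_fun F).
Proof. by move=> x; rewrite -[LHS]/((_ \o _) x) -lift_funM mulgV lift_fun1. Qed.

Definition lift_homeo F : homeo X1 :=
  Homeo (lift_funK F) (lift_funVK F)
    (@lift_fun_continuous F) (@lift_fun_continuous F^-1%g).

Lemma lift_homeo_full F : lift_homeo F \in full_group_set T1.
Proof.
by apply/mem_set; exists (cocycle F \o f) => //; exact: lift_cocycle_continuous.
Qed.

Definition lift F : topological_full_group T1 := SigSub (lift_homeo_full F).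

Lemma liftM : {morph lift : F G / (F * G)%g}.
Proof. by move=> F G; apply/val_inj/homeo_ext => x; exact: lift_funM. Qed.

(** By the intertwining relation, [lift F] determines [F] on the image of [f], which is all of
    [X2]. *)
Lemma lift_inj : set_surj [set: X1] [set: X2] f -> injective lift.
Proof.
move=> sf F G FG; apply/val_inj/homeo_ext => y; have [x _ <-] := sf y I.
rewrite -!lift_fun_intertwine.
by rewrite -[lift_fun F x]/(val (lift F) x) FG.
Qed.

End Lift.

Theorem theorem1p2 (R : realType) (X1 X2 : topologicalType)
    (hX1 : cantor_set R X1) (hX2 : cantor_set R X2)
    (T1 : homeo X1) (T2 : homeo X2)
    (hT1 : aperiodic T1) (hT2 : aperiodic T2)
    (hfactor : continuous_factor T2 T1) :
  exists phi : {multiplicative (topological_full_group T2) -> (topological_full_group T1)},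
    injective phi.
Proof.
have [f [cf sf fT]] := hfactor.
pose m := isMultiplicative.Build _ _ (lift hT2 cf fT) (liftM hT2 cf fT).
pose phi : {multiplicative _ -> _} := HB.pack (lift hT2 cf fT) m.
by exists phi; exact: lift_inj.
Qed.
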